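(* There exists a positive integer $d$ such that $\mathrm{Gr}(2) \le \mathrm{TTT}(4,2,d) + 1$; for example, $d = 2\uparrow\uparrow 18$ works.
   Context: For a finite alphabet $A$ with $|A|\ge 2$ and a group $G$ acting on $A$, a $k$-parameter subset of $A^n$ is the image of an injective map $f : A^k \to A^n$ such that for each coordinate $1 \le i \le n$, either $f_i(x_1,\dots,x_k) = a$ for some constant $a \in A$, or $f_i(x_1,\dots,x_k) = \sigma(x_j)$ for some $1\le j\le k$ and some $\sigma \in G$. Tic-tac-toe numbers: take $A = [t]$ and $G = \{e,\pi\}$ with $e(x)=x$, $\pi(x) = t+1-x$; a $d$-parameter subset of $[t]^n$ is a $d$-dimensional tic-tac-toe space, and $\mathrm{TTT}(t,k,d)$ is the least $n$ such that every $k$-coloring of the points of $[t]^n$ contains a monochromatic $d$-dimensional tic-tac-toe space. Graham numbers: take $A = \{\pm 1\}$ and $G = \{x\mapsto x, x \mapsto -x\}$; a $d$-parameter subset of $\{\pm1\}^n$ is a $d$-dimensional subcube. An edge-coloring of $\{\pm1\}^n$ is a $2$-coloring of the edges of the complete graph on $\{\pm1\}^n$. $\mathrm{Gr}(2)$ is the least $n$ such that every edge-coloring of $\{\pm1\}^n$ contains a $2$-dimensional subcube all $6$ of whose edges have the same color. Knuth up-arrow notation: $a\uparrow b = a^b$, and $a \uparrow\uparrow b = a\uparrow(a\uparrow(\cdots\uparrow a))$ with $b$ copies of $a$ (a right-associated tower of height $b$). *)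

(* Defs.v *)
From HB Require Import structures.
From mathcomp Require Import all_boot all_fingroup.
Set Implicit Arguments.
Unset Strict Implicit.
Unset Printing Implicit Defensive.

Notation point A n := {ffun 'I_n -> A}.

(* A group acting on A enters only through the maps it induces on A, so it is
   taken to be a group of permutations of A. *)
Definition param_map (A : finType) (G : {group {perm A}}) (k n : nat)
    (f : point A k -> point A n) : Prop :=
  injective f /\
  forall i : 'I_n,
    (exists a : A, forall x, f x i = a) \/
    (exists (j : 'I_k) (s : {perm A}), s \in G /\ forall x, f x i = s (x j)).

Definition param_subset (A : finType) (G : {group {perm A}}) (k n : nat)
    (S : {set point A n}) : Prop :=
  exists f : point A k -> point A n,
    param_map G f /\ S = [set f x | x in [set: point A k]].

Lemma involution_group_set (A : finType) (s : {perm A}) :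
  (s * s = 1)%g -> group_set [set 1%g; s].
Proof.
move=> ss; apply/group_setP; split; first by rewrite !inE eqxx.
by move=> x y /set2P[]-> /set2P[]->; rewrite ?mul1g ?mulg1 ?ss !inE eqxx ?orbT.
Qed.

Definition is_least (P : nat -> Prop) (n : nat) : Prop :=
  P n /\ forall m, P m -> n <= m.

(* 'I_t is [t] shifted to {0, ..., t - 1}, so t + 1 - x becomes
   rev_ord x = t - 1 - x. *)
Definition flip (t : nat) : {perm 'I_t} := perm (@rev_ord_inj t).

Lemma flip_invol t : (flip t * flip t = 1)%g.
Proof. by apply/permP=> x; rewrite permM !permE rev_ordK. Qed.

Definition ttt_group (t : nat) : {group {perm 'I_t}} :=
  Group (involution_group_set (flip_invol t)).

Definition ttt_space (t d n : nat) (S : {set point 'I_t n}) : Prop :=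
  param_subset (ttt_group t) d S.

Definition ttt_unavoidable (t k d n : nat) : Prop :=
  forall c : point 'I_t n -> 'I_k,
  exists S : {set point 'I_t n},
    ttt_space d S /\ exists col : 'I_k, forall x, x \in S -> c x = col.

Definition is_TTT (t k d : nat) : nat -> Prop :=
  is_least (ttt_unavoidable t k d).

(* The alphabet {+1, -1} is encoded as bool, with negb for x |-> -x. *)
Definition neg_perm : {perm bool} := perm (inv_inj negbK).

Lemma neg_perm_invol : (neg_perm * neg_perm = 1)%g.
Proof. by apply/permP=> x; rewrite permM !permE negbK. Qed.

Definition cube_group : {group {perm bool}} :=
  Group (involution_group_set neg_perm_invol).

Definition subcube (d n : nat) (S : {set point bool n}) : Prop :=
  param_subset cube_group d S.

(* An edge is a two-element set of points; the values of c on the other sets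
   are never used. *)
Definition gr_unavoidable (d n : nat) : Prop :=
  forall c : {set point bool n} -> 'I_2,
  exists S : {set point bool n},
    subcube d S /\
    exists col : 'I_2,
      forall e : {set point bool n}, #|e| = 2 -> e \subset S -> c e = col.

Definition is_Gr (d : nat) : nat -> Prop := is_least (gr_unavoidable d).

(* For b = 0 the tower is 1; for b > 0 the innermost a ^ 1 is the last of the
   b copies of a. *)
Definition up_up (a b : nat) : nat := iter b (expn a) 1.
Arguments up_up : simpl never.

(* Main.v *)
From Stdlib Require Import Classical.
Require Import Defs.
From mathcomp Require Import all_boot all_fingroup.
From mathcomp Require Import zify.
Set Implicit Arguments.
Unset Strict Implicit.
Unset Printing Implicit Defensive.

(** A letter of [4] encodes a pair of signs, so a word of length n encodes an edge
    of the (n+1)-cube in the direction of the last coordinate, and the flip of [4]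
    negates both signs. A monochromatic d-dimensional tic-tac-toe space thus becomes
    a (d+1)-dimensional subcube in which all edges between the two halves have the
    same colour, say red.

    Call the difference of two points of the d-cube, up to sign, the direction of
    the edge joining them. If in some direction there is a red edge in both halves,
    these two edges span a red square. Otherwise each direction is free of red in
    one of the two halves, which 2-colours the nonzero vectors over {0, +1, -1}. It
    then suffices to find vectors a, b with disjoint supports such that a, b, a + b,
    a - b have the same colour: they span a square in one half without a red edge.

    For this, apply Ramsey's theorem for 5-subsets of the coordinates to vectors that
    are constant on consecutive intervals: after passing to 9 coordinates, the colour
    of such a vector depends only on its pattern of signs, for the 7 patterns needed.
    Each level of Ramsey's theorem costs two exponentials and a shift that is
    absorbed by a third one, which leads from 9 to a bound below 2^^17. *)

(** * Ramsey's theorem *)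

Lemma pigeonhole_count (T : Type) (C : finType) (f : T -> C) (c0 : C) m s :
  m * #|C| <= size s -> exists k : C, m <= count (fun y => f y == k) s.
Proof.
move=> hs; apply/existsP; apply: contraLR hs.
rewrite negb_exists -ltnNge => /forallP h.
have -> : size s = \sum_(k : C) count (fun y => f y == k) s.
  elim: s {h} => [|y s IH] /=; first by rewrite big1.
  rewrite big_split /= -IH (bigD1 (f y)) //= eqxx big1 // => k.
  by rewrite eq_sym => /negbTE->.
case: m h => [/(_ c0)|m h]; first by rewrite leq0n.
apply: (@leq_ltn_trans (\sum_(k : C) m)).
  by apply: leq_sum => k _; rewrite -ltnS ltnNge h.
by rewrite sum_nat_const mulnC ltn_pmul2r // (cardD1 c0).
Qed.

Section Ramsey.
Variable T : eqType.

(* Recording [c u] and [c (x :: u)] together squares the number of colours, so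
   the induction on [j] ranges over all colour types. *)
Lemma end_homogeneous (j r : nat) (C : finType) (c : seq T -> C) (s : seq T) :
  #|C| <= r -> 1 < r -> r ^ (2 ^ j.+1 - 2) <= size s ->
  exists t, [/\ subseq t s, size t = j & forall u y z,
    subseq (rcons u y) t -> subseq (rcons u z) t ->
    c (rcons u y) = c (rcons u z)].
Proof.
elim: j r C c s => [|j IH] r C c s Cr r1 hs.
  exists [::]; split; rewrite ?sub0seq // => u y z.
  by rewrite subseq0; case: u.
(* One factor [r] pays for the pigeonhole and one, as [1 < r], for removing the head [x]; squaring
   the colours doubles the remaining exponent. *)
have hexp : r * (r * (r ^ 2) ^ (2 ^ j.+1 - 2)) = r ^ (2 ^ j.+2 - 2).
  rewrite -expnM -!expnS; congr (_ ^ _).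
  have : 2 <= 2 ^ j.+1 by rewrite expnS leq_pmulr // expn_gt0.
  rewrite (expnS 2 j.+1); lia.
have [|k hk] := @pigeonhole_count T C (fun y => c [:: y]) (c [::])
  (r * (r ^ 2) ^ (2 ^ j.+1 - 2)) s.
  by apply: leq_trans hs; rewrite -hexp [X in _ <= X]mulnC leq_mul2l Cr orbT.
rewrite -size_filter in hk.
have ss := filter_subseq (fun y => c [:: y] == k) s.
have := filter_all (fun y => c [:: y] == k) s.
case E: (filter _ _) hk ss => [|x s1] /=.
  by rewrite leqNgt muln_gt0 !expn_gt0 (ltnW r1).
move=> hk ss /andP[/eqP cx /allP cs1].
have [|||t [ts1 st ht]] :=
    IH (r ^ 2) (C * C)%type (fun u => (c u, c (x :: u))) s1.
- by rewrite card_prod -mulnn leq_mul.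
- by rewrite -{1}(exp1n 2) ltn_exp2r.
- rewrite -ltnS; apply: leq_trans hk.
  have : 0 < (r ^ 2) ^ (2 ^ j.+1 - 2) by rewrite !expn_gt0 (ltnW r1).
  nia.
exists (x :: t); split => [||u y z].
- by apply: subseq_trans ss; rewrite /= eqxx.
- by rewrite /= st.
have cE y' : y' \in x :: t -> c [:: y'] = k.
  rewrite inE => /orP[/eqP->//|yt].
  by apply/eqP/cs1; rewrite (mem_subseq ts1).
case: u => [|a u]; first by rewrite !sub1seq => /cE -> /cE ->.
rewrite /=; case: eqP => [->|_] h1 h2.
  by have [] := ht u y z h1 h2.
by have [] := ht (a :: u) y z h1 h2.
Qed.

Fixpoint ramsey_bound (r n k : nat) : nat :=
  if k is k'.+1 then r ^ 2 ^ (ramsey_bound r n k').+2 else n.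

(** In an end-homogeneous list with last element [z], replacing the last element of a set by [z]
    keeps its colour, so sets of size [k + 1] reduce to sets of size [k] avoiding [z]. *)
Lemma ramsey (k n r : nat) (C : finType) (c : seq T -> C) (s : seq T) :
  #|C| <= r -> 1 < r -> ramsey_bound r n k <= size s ->
  exists t, [/\ subseq t s, size t = n & exists col, forall u,
    subseq u t -> size u = k -> c u = col].
Proof.
move=> Cr r1; elim: k c s => [|k IH] c s /= hs.
  exists (take n s); split; rewrite ?take_subseq ?size_take_min ?(minn_idPl hs) //.
  by exists (c [::]) => u _ /size0nil ->.
have [|t [ts st ht]] := @end_homogeneous (ramsey_bound r n k).+1 r C c s Cr r1.
  by apply: leq_trans hs; rewrite leq_exp2l // leq_subr.
case/lastP: t ts st ht => [|t z] // ts.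
rewrite size_rcons => -[st] ht.
have [|t' [t't st' [col hcol]]] := IH (fun u => c (rcons u z)) t.
  by rewrite st.
exists t'; split=> //.
  by apply: subseq_trans t't _; apply: subseq_trans ts; apply: subseq_rcons.
exists col => u; case/lastP: u => [|u x] // ut'.
rewrite size_rcons => -[su].
have ut : subseq u t' by apply: subseq_trans ut'; apply: subseq_rcons.
rewrite -(hcol u ut su); apply: ht.
  apply: subseq_trans (subseq_trans ut' t't) _; apply: subseq_rcons.
by rewrite -!cats1 cat_subseq // (subseq_trans ut).
Qed.

End Ramsey.

(** * Bounding the Ramsey number by a tower *)

Lemma up_upS a b : up_up a b.+1 = a ^ up_up a b.
Proof. by []. Qed.

Lemma up_up_gt0 b : 0 < up_up 2 b.
Proof. by case: b => // b; rewrite up_upS expn_gt0. Qed.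

Lemma up_up_leqS b : up_up 2 b <= up_up 2 b.+1.
Proof. by rewrite up_upS ltnW // ltn_expl. Qed.

Lemma up_up_add5 b : up_up 2 b.+3 + 5 <= up_up 2 b.+4.
Proof.
have : 4 <= up_up 2 b.+3.
  by rewrite !up_upS (@leq_exp2l 2 2) // (@leq_exp2l 2 1) // expn_gt0.
rewrite (up_upS 2 b.+3); move: (up_up 2 b.+3) => x.
elim: x => // x IH; rewrite leq_eqVlt => /orP[/eqP <- //|].
rewrite expnS => /IH; lia.
Qed.

(** The shift 5 is 2 from [x.+2] plus 3 from [7 <= 2 ^ 3]. *)
Lemma ramsey_bound_step x b :
  x + 5 <= up_up 2 b -> (2 ^ 7) ^ 2 ^ x.+2 <= up_up 2 b.+2.
Proof.
move=> hx; rewrite !up_upS -expnM leq_exp2l //.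
apply: (@leq_trans (2 ^ (x + 5))); last by rewrite leq_exp2l.
rewrite -(addn2 x) !expnD; lia.
Qed.

Lemma ramsey_bound_up_up : ramsey_bound (2 ^ 7) 9 5 <= up_up 2 17.
Proof.
have h0 : 9 + 5 <= up_up 2 3 by [].
have step x b : x + 5 <= up_up 2 b.+1 ->
    (2 ^ 7) ^ 2 ^ x.+2 + 5 <= up_up 2 b.+4.
  by move/ramsey_bound_step => h; apply: leq_trans (up_up_add5 _); rewrite leq_add2r.
(* The height starts at 3, grows by 3 at each of four levels, and by 2 at the last one, where no
   shift has to be absorbed. *)
exact: ramsey_bound_step (step _ 11 (step _ 8 (step _ 5 (step _ 2 h0)))).
Qed.

(** * The Hales-Jewett theorem *)

Section HalesJewett.
Variable A : finType.

(* A variable word is a word over [option A] in which [None] is the variable. *)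
Definition subst (w : seq (option A)) (a : A) : seq A := map (odflt a) w.

Definition line_on (n : nat) (w : seq (option A)) : Prop :=
  size w = n /\ None \in w.

Definition constant_on (C : Type) (c : seq A -> C) (L : seq A)
    (w : seq (option A)) (k : C) : Prop :=
  forall a, a \in L -> c (subst w a) = k.

(* Only the values of the variable are restricted to [L]; the constants of the
   line are arbitrary letters. *)
Definition hales_jewett (L : seq A) : Prop :=
  forall C : finType, exists n, forall c : seq A -> C,
  exists w k, line_on n w /\ constant_on c L w k.

Lemma subst_cat w w' a : subst (w ++ w') a = subst w a ++ subst w' a.
Proof. exact: map_cat. Qed.

Lemma subst_Some u a : subst (map Some u) a = u.
Proof. by rewrite /subst -map_comp map_id. Qed.

Lemma line_cat n n' w w' : line_on n w -> size w' = n' -> line_on (n + n') (w ++ w').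
Proof. by move=> [<- wN] <-; split; rewrite ?size_cat // mem_cat wN. Qed.

Lemma cat_line n n' w w' : size w = n -> line_on n' w' -> line_on (n + n') (w ++ w').
Proof. by move=> <- [<- wN]; split; rewrite ?size_cat // mem_cat wN orbT. Qed.

(* For [m] larger than the number of colours the second alternative is impossible. *)
Lemma color_focusing (a0 b : A) (L : seq A) (C : finType) (m : nat) :
  a0 \in L -> hales_jewett L ->
  exists n, forall c : seq A -> C,
    (exists w k, line_on n w /\ constant_on c (b :: L) w k) \/
    exists (f : seq A) (K : seq C),
      [/\ size f = n, uniq K, size K = m & forall k, k \in K ->
        exists w, [/\ line_on n w, subst w b = f & constant_on c L w k]].
Proof.
move=> a0L HJ; elim: m => [|m [n IH]].
  by exists 0 => c; right; exists [::], [::]; split.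
(* A prefix is coloured by the map it induces on suffixes, so along the line [w'] all letters of [L]
   induce the same [c0]. *)
have [n' HJn'] := HJ {ffun n.-tuple A -> C}.
exists (n' + n) => c.
have [w' [g [lw' hw']]] := HJn' (fun u => [ffun v : n.-tuple A => c (u ++ v)]).
pose c0 v := c (subst w' a0 ++ v).
have c0E a v : a \in L -> size v = n -> c (subst w' a ++ v) = c0 v.
  move=> aL /eqP sv; have := hw' a aL; rewrite -(hw' a0 a0L).
  by move/ffunP/(_ (Tuple sv)); rewrite !ffunE.
have size_subst w a : line_on n w -> size (subst w a) = n.
  by move=> [<- _]; rewrite size_map.
case: (IH c0) => [[w [k [lw hw]]]|[f [K [sf uK sK hK]]]].
  left; exists (map Some (subst w' a0) ++ w), k; split.
    by apply: cat_line => //; rewrite !size_map; case: lw'.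
  by move=> a aL; rewrite subst_cat subst_Some -(hw a aL).
case: (boolP (c0 f \in K)) => [fK|fK].
  have [w [lw wb hw]] := hK _ fK.
  left; exists (map Some (subst w' a0) ++ w), (c0 f); split.
    by apply: cat_line => //; rewrite !size_map; case: lw'.
  move=> a; rewrite subst_cat subst_Some inE => /orP[/eqP->|aL].
    by rewrite wb.
  by rewrite -(hw a aL).
(* The colour [c0 f] is new: [w'] followed by the constant [f] realises it, the old lines now vary
   together with [w'], and all meet at the new focus. *)
right; exists (subst w' b ++ f), (c0 f :: K); split.
- by rewrite size_cat sf size_map; case: lw' => ->.
- by rewrite /= fK.
- by rewrite /= sK.
move=> k; rewrite inE => /orP[/eqP->|kK].
  exists (w' ++ map Some f); split; rewrite ?subst_cat ?subst_Some //.
    by apply: line_cat; rewrite ?size_map.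
  by move=> a aL; rewrite subst_cat subst_Some c0E.
have [w [lw wb hw]] := hK _ kK; exists (w' ++ w); split.
- by apply: line_cat => //; case: lw.
- by rewrite subst_cat wb.
by move=> a aL; rewrite subst_cat c0E ?size_subst // hw.
Qed.

Lemma hales_jewett_all (L : seq A) : hales_jewett L.
Proof.
elim: L => [|b [_|a0 L HJ]] C.
- by exists 1 => c; exists [:: None], (c [::]).
- exists 1 => c; exists [:: None], (c [:: b]); split=> // a.
  by rewrite inE => /eqP ->.
have [n hn] := @color_focusing a0 b (a0 :: L) C #|C|.+1 (mem_head _ _) HJ.
exists n => c; case: (hn c) => // -[f [K [_ uK sK _]]].
by have := max_card (mem K); rewrite (card_uniqP uK) sK ltnn.
Qed.

End HalesJewett.

(* A line over the alphabet [A ^ d] is a [d]-dimensional space over [A]. *)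
Lemma param_subset_ramsey (A : finType) (G : {group {perm A}}) (C : finType)
    (a0 : A) (d : nat) :
  exists n, forall c : point A n -> C, exists S : {set point A n},
    param_subset G d S /\ exists k, forall x, x \in S -> c x = k.
Proof.
have [n hn] := @hales_jewett_all (point A d) (enum (point A d)) C.
exists #|{: 'I_n * 'I_d}| => c.
pose pos (i : 'I_#|{: 'I_n * 'I_d}|) : 'I_n * 'I_d := enum_val i.
pose x0 : point A d := [ffun=> a0].
pose flat (s : seq (point A d)) : point A #|{: 'I_n * 'I_d}| :=
  [ffun i => nth x0 s (pos i).1 (pos i).2].
have [w [k [[sw wN] hw]]] := hn (c \o flat).
pose f x := flat (subst w x).
have fE x i : f x i = odflt x (nth None w (pos i).1) (pos i).2.
  by rewrite ffunE (nth_map None) // sw.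
exists [set f x | x in [set: point A d]]; split; last first.
  by exists k => _ /imsetP[x _ ->]; apply: hw; rewrite mem_enum.
exists f; split=> //; split.
  move=> x y /ffunP fxy; apply/ffunP => l.
  have pw : index None w < n by rewrite -sw index_mem.
  have := fxy (enum_rank (Ordinal pw, l)).
  by rewrite !fE /pos enum_rankK /= nth_index.
move=> i; case E: (nth None w (pos i).1) => [a|].
  by left; exists (a (pos i).2) => x; rewrite fE E.
right; exists (pos i).2, 1%g; split; first exact: group1.
by move=> x; rewrite fE E perm1.
Qed.

(** * Directions *)

(* A direction in the cube is a nonzero vector over {0, +1, -1}; here [None] is
   0, [Some false] is +1 and [Some true] is -1. *)
Notation vec d := {ffun 'I_d -> option bool}.
Notation P1 := (Some false).
Notation M1 := (Some true).

Definition opp_sign (e : option bool) : option bool := omap negb e.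

Definition disjoint_vec d (a b : vec d) : Prop :=
  forall j, a j = None \/ b j = None.

Definition nonzero d (a : vec d) : Prop := exists j, a j != None.

(* The sum and the difference of two vectors with disjoint supports. *)
Definition addv d (a b : vec d) : vec d :=
  [ffun j => if a j is None then b j else a j].
Definition subv d (a b : vec d) : vec d :=
  [ffun j => if a j is None then opp_sign (b j) else a j].

(* The vector taking the value [w_i] on the interval [[h_i, h_(i+1))]. *)
Fixpoint block (h : seq nat) (w : seq (option bool)) (j : nat) : option bool :=
  match h, w with
  | x :: (y :: _) as h', e :: w' => if x <= j < y then e else block h' w' j
  | _, _ => None
  end.

Definition blockv d h w : vec d := [ffun j : 'I_d => block h w j].

(* The seven block patterns +, +-, +0+, +0-, +-+, +-+-, +-0- . *)
Definition pattern_colors d (chi : vec d -> bool) (u : seq nat) :=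
  let V w := chi (blockv d u w) in
  (V [:: P1], V [:: P1; M1], V [:: P1; None; P1], V [:: P1; None; M1],
   V [:: P1; M1; P1], V [:: P1; M1; P1; M1], V [:: P1; M1; None; M1]).


Lemma blockv_nonzero d x y (h : seq nat) (e : bool) w :
  x < y -> x < d -> nonzero (blockv d [:: x, y & h] (Some e :: w)).
Proof. by move=> xy xd; exists (Ordinal xd); rewrite ffunE /= leqnn xy. Qed.

(* An identity between block vectors is checked on each interval of cuts; [pos]
   says that the truth values of [x 0 <= j, ..., x 5 <= j] are nonincreasing. *)
Local Ltac by_position x pos :=
  let j := fresh "j" in
  rewrite /addv /subv /disjoint_vec; (try apply/ffunP);
  move=> j; move: (pos j); rewrite !ffunE /= !ltnNge;
  case: (x 0 <= j); case: (x 1 <= j); case: (x 2 <= j);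
  case: (x 3 <= j); case: (x 4 <= j); case: (x 5 <= j);
  by [| left | right].

(* After Ramsey's theorem the seven patterns have colours [A, ..., G]. Each clause
   [n...] below rules out, by an explicit pair of vectors, that the listed colours
   coincide; the clauses together are unsatisfiable by two colours. *)
Lemma same_color_directions r d (chi : vec d -> bool) :
  2 ^ 7 <= r -> ramsey_bound r 9 5 <= d ->
  exists a b : vec d,
    [/\ disjoint_vec a b, nonzero a & nonzero b] /\
    [/\ chi a = chi b, chi (addv a b) = chi b & chi (subv a b) = chi b].
Proof.
move=> hr hd.
have [|||t [tsub st [col hcol]]] :=
    @ramsey _ 5 9 r _ (@pattern_colors d chi) (iota 0 d).
- by rewrite !card_prod card_bool.
- exact: leq_trans hr.
- by rewrite size_iota.
pose x := nth 0 t.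
have xd i : i < 9 -> x i < d.
  move=> i9; have := mem_nth 0 (s := t) (n := i).
  by rewrite st => /(_ i9) /(mem_subseq tsub); rewrite mem_iota.
have xS i : i.+1 < 9 -> x i < x i.+1.
  have := subseq_sorted ltn_trans tsub (iota_ltn_sorted 0 d).
  by move=> /(sortedP 0); rewrite st => h; apply: h.
have hc k : size k = 5 -> subseq k (iota 0 9) ->
    pattern_colors chi (map x k) = col.
  move=> sk ks; apply: hcol; rewrite ?size_map //.
  by rewrite -(mkseq_nth 0 t) st; apply: map_subseq.
case: col hc {hcol} => [[[[[[A B] C] D] E] F] G] hc.
clear hr hd.
(* A shorter list of cuts is completed to five by the last three of the nine. *)
have ext k : 2 <= size k <= 5 -> subseq k (iota 0 6) ->
    pattern_colors chi (map x (take 5 (k ++ [:: 6; 7; 8]))) = (A, B, C, D, E, F, G).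
  move=> /andP[k2 k5] ks; apply: hc.
    rewrite size_take_min size_cat; apply/minn_idPl.
    exact: (leq_add k2 (leqnn 3)).
  apply: subseq_trans (take_subseq _ _) _.
  exact: (cat_subseq ks (subseq_refl [:: 6; 7; 8])).
pose V k w := blockv d (map x k) w.
have hA i j : subseq [:: i; j] (iota 0 6) -> chi (V [:: i; j] [:: P1]) = A.
  by move/(ext [:: i; j] erefl) => [].
have hB i j k : subseq [:: i; j; k] (iota 0 6) ->
    chi (V [:: i; j; k] [:: P1; M1]) = B.
  by move/(ext [:: i; j; k] erefl) => [].
have hC i j k l : subseq [:: i; j; k; l] (iota 0 6) ->
    chi (V [:: i; j; k; l] [:: P1; None; P1]) = C.
  by move/(ext [:: i; j; k; l] erefl) => [].
have hD i j k l : subseq [:: i; j; k; l] (iota 0 6) ->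
    chi (V [:: i; j; k; l] [:: P1; None; M1]) = D.
  by move/(ext [:: i; j; k; l] erefl) => [].
have hE i j k l : subseq [:: i; j; k; l] (iota 0 6) ->
    chi (V [:: i; j; k; l] [:: P1; M1; P1]) = E.
  by move/(ext [:: i; j; k; l] erefl) => [].
have hF i j k l m : subseq [:: i; j; k; l; m] (iota 0 6) ->
    chi (V [:: i; j; k; l; m] [:: P1; M1; P1; M1]) = F.
  by move/(ext [:: i; j; k; l; m] erefl) => [].
have hG i j k l m : subseq [:: i; j; k; l; m] (iota 0 6) ->
    chi (V [:: i; j; k; l; m] [:: P1; M1; None; M1]) = G.
  by move/(ext [:: i; j; k; l; m] erefl) => [].
have pos (j : nat) : [&& (x 1 <= j) ==> (x 0 <= j), (x 2 <= j) ==> (x 1 <= j),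
    (x 3 <= j) ==> (x 2 <= j), (x 4 <= j) ==> (x 3 <= j) & (x 5 <= j) ==> (x 4 <= j)].
  by rewrite -!(rwP andP); do ?split; apply/implyP; apply: leq_trans; apply: ltnW;
    apply: xS.
have xlt i j : i < j < 9 -> x i < x j.
  case/andP; elim: j => // j IH; rewrite ltnS leq_eqVlt.
  move=> /orP[/eqP <-|ij] j9; first exact: xS.
  exact: ltn_trans (IH ij (ltnW j9)) (xS _ j9).
have mono i j ka wa i' j' kb wb ks ws kd wd :
    let a := V [:: i, j & ka] (P1 :: wa) in
    let b := V [:: i', j' & kb] (P1 :: wb) in
    i < j < 9 -> i' < j' < 9 ->
    disjoint_vec a b -> addv a b = V ks ws -> subv a b = V kd wd ->
    chi a = chi b -> chi (V ks ws) = chi b -> chi (V kd wd) = chi b ->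
  exists a b : vec d,
    [/\ disjoint_vec a b, nonzero a & nonzero b] /\
    [/\ chi a = chi b, chi (addv a b) = chi b & chi (subv a b) = chi b].
  move=> a b ij ij' ab sab dab ca cs cd; exists a, b; rewrite sab dab.
  have V0 k l m w : k < l < 9 -> nonzero (V [:: k, l & m] (P1 :: w)).
    by move=> kl; apply: blockv_nonzero; rewrite ?xlt ?xd //; lia.
  by split=> //; split=> //; apply: V0.
move: mono; set goal := (exists a b, _) => mono.
have nAB : A = B -> goal.
  move=> AB; apply: (@mono 0 1 [::] [::] 1 2 [::] [::]
    [:: 0; 2] [:: P1] [:: 0; 1; 2] [:: P1; M1]);
    rewrite ?hA ?hB //; by_position x pos.
have nAEF : A = E -> A = F -> goal.
  move=> AE AF; apply: (@mono 0 1 [:: 2; 3] [:: M1; P1] 3 4 [::] [::]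
    [:: 0; 1; 2; 4] [:: P1; M1; P1] [:: 0; 1; 2; 3; 4] [:: P1; M1; P1; M1]);
    rewrite ?hA ?hE ?hF //; by_position x pos.
have nADG : A = D -> A = G -> goal.
  move=> AD AG; apply: (@mono 0 1 [:: 3; 4] [:: None; M1] 1 2 [::] [::]
    [:: 0; 2; 3; 4] [:: P1; None; M1] [:: 0; 1; 2; 3; 4] [:: P1; M1; None; M1]);
    rewrite ?hA ?hD ?hG //; by_position x pos.
have nBCE : B = C -> B = E -> goal.
  move=> BC BE; apply: (@mono 0 1 [:: 3; 4] [:: None; P1] 1 2 [:: 3] [:: M1]
    [:: 0; 2; 3; 4] [:: P1; M1; P1] [:: 0; 1; 2; 4] [:: P1; M1; P1]);
    rewrite ?hB ?hC ?hE //; by_position x pos.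
have nACF : A = C -> A = F -> goal.
  move=> eAC AF; apply: (@mono 0 1 [:: 2; 3] [:: None; P1] 1 2 [:: 3; 4] [:: None; P1]
    [:: 0; 4] [:: P1] [:: 0; 1; 2; 3; 4] [:: P1; M1; P1; M1]);
    rewrite ?hA ?hC ?hF -?eAC //; by_position x pos.
have nBDF : B = D -> B = F -> goal.
  move=> BD BF; apply: (@mono 0 1 [:: 3; 4] [:: None; M1] 1 2 [:: 3] [:: M1]
    [:: 0; 2; 4] [:: P1; M1] [:: 0; 1; 2; 3; 4] [:: P1; M1; P1; M1]);
    rewrite ?hB ?hD ?hF //; by_position x pos.
have nBFG : B = F -> B = G -> goal.
  move=> BF BG; apply: (@mono 0 1 [:: 2; 4; 5] [:: M1; None; M1] 2 3 [:: 4] [:: M1]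
    [:: 0; 1; 2; 3; 5] [:: P1; M1; P1; M1] [:: 0; 1; 3; 4; 5] [:: P1; M1; P1; M1]);
    rewrite ?hB ?hF ?hG //; by_position x pos.
clear hA hB hC hD hE hF hG ext hc.
(* By hand: [A] and [B] differ. If [F = B], then [D = G = A], against [nADG]; if [F = A], then
   [C = E = B], against [nBCE]. *)
case: A B C D E F G nAB nAEF nADG nBCE nACF nBDF nBFG => [] [] [] [] [] [] []; auto.
Qed.

(** * Squares in the cube *)

Lemma cube_param_map k n (f : point bool k -> point bool n) :
  injective f ->
  (forall i, (exists a, forall x, f x i = a) \/
             (exists j e, forall x, f x i = e (+) x j)) ->
  param_map cube_group f.
Proof.
move=> finj hf; split=> // i; case: (hf i) => [|[j [e fi]]]; first by left.
right; exists j, (if e then neg_perm else 1%g); split.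
  by case: (e); rewrite !inE eqxx ?orbT.
by move=> x; rewrite fi; case: (e); rewrite ?permE.
Qed.

Lemma bool_fun_sign (a : bool -> bool) :
  (exists b, forall h, a h = b) \/ (exists e, forall h, a h = e (+) h).
Proof.
case: (a true =P a false) => h; [left; exists (a true) | right; exists (a false)];
  by case; move: h; case: (a true) (a false) => [] [].
Qed.

Lemma subset_image_pair (aT rT : finType) (f : aT -> rT) (e : {set rT}) :
  #|e| = 2 -> e \subset [set f x | x in [set: aT]] ->
  exists x y, x != y /\ e = [set f x; f y].
Proof.
move=> /eqP/cards2P[u [v [uv ->]]] /subsetP h.
have /imsetP[x _ ux] := h u (set21 _ _); have /imsetP[y _ vy] := h v (set22 _ _).
exists x, y; rewrite ux vy; split=> //; apply: contra uv => /eqP xy.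
by rewrite ux vy xy.
Qed.

Definition line_point d (v : vec d) (x : point bool d) (z : bool) : point bool d :=
  [ffun j => if v j is Some e then e (+) z else x j].

Lemma line_point_inj d (v : vec d) x y z z' : nonzero v ->
  line_point v x z = line_point v y z' -> z = z'.
Proof.
move=> [j vj] /ffunP/(_ j); rewrite !ffunE.
by case: (v j) vj => // e _; case: e z z' => [] [] [].
Qed.

(** The value [true] off both supports is arbitrary: a half free of red in a direction is so for
    every base point. *)
Definition plane_point d (a b : vec d) (z : point bool 2) : point bool d :=
  [ffun j => if a j is Some e then e (+) z ord0
             else if b j is Some e then e (+) z ord_max else true].

Lemma point2P (z w : point bool 2) :
  z ord0 = w ord0 -> z ord_max = w ord_max -> z = w.
Proof.
move=> h0 h1; apply/ffunP => -[[|[|//]] hi].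
  by rewrite (_ : Ordinal hi = ord0) //; apply/val_inj.
by rewrite (_ : Ordinal hi = ord_max) //; apply/val_inj.
Qed.

(** Sides of the square have direction [a] or [b]; a diagonal has direction [addv a b] or
    [subv a b], as the two parameters of [z] agree or not. *)
Lemma plane_point_line d (a b : vec d) (z w : point bool 2) :
  disjoint_vec a b -> z != w ->
  exists v k x, [/\ v \in [:: a; b; addv a b; subv a b], z k != w k,
    plane_point a b z = line_point v x (z k) &
    plane_point a b w = line_point v x (w k)].
Proof.
move=> dab zw.
have [z0|z0] := eqVneq (z ord0) (w ord0).
  have z1 : z ord_max != w ord_max by apply: contra zw => /eqP h; rewrite (point2P z0 h).
  exists b, ord_max, (plane_point a b z); split; rewrite ?inE ?eqxx ?orbT //;
    by apply/ffunP => j; rewrite !ffunE -?z0; case: (dab j) => ->; case: (_ j).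
have [z1|z1] := eqVneq (z ord_max) (w ord_max).
  exists a, ord0, (plane_point a b z); split; rewrite ?inE ?eqxx ?orbT //;
    by apply/ffunP => j; rewrite !ffunE -?z1; case: (dab j) => ->; case: (_ j).
exists (if z ord0 == z ord_max then addv a b else subv a b), ord0, (plane_point a b z).
split; rewrite ?z0 //; first by case: ifP; rewrite !inE eqxx ?orbT.
  apply/ffunP => j; rewrite [LHS]ffunE [RHS]ffunE.
  case: eqP => [E|/eqP E]; rewrite !ffunE;
  case: (a j) => //; case: (b j) => //= e.
    by rewrite E.
  by move: E; case: e (z _) (z _) => [] [] [].
apply/ffunP => j; rewrite [LHS]ffunE [RHS]ffunE.
case: (z ord0 =P z ord_max) => [E|/eqP E]; rewrite !ffunE;
  case: (a j) => //; case: (b j) => //= e.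
  by move: z0 z1; rewrite E; case: e (z _) (w ord0) (w ord_max) => [] [] [] [].
by move: E z0 z1; case: e (z _) (z _) (w ord0) (w ord_max) => [] [] [] [] [].
Qed.

Section TwoHalves.
Variables (d m : nat) (c : {set point bool m} -> 'I_2) (R : 'I_2).
Variable P : bool -> point bool d -> point bool m.
Hypothesis P_inj : forall h x h' y, P h x = P h' y -> h = h' /\ x = y.
(** A constant letter of [4] may have different signs in the two halves, whereas a flip acts by the
    same [e] on both. *)
Hypothesis P_coord : forall i, (exists a : bool -> bool, forall h x, P h x i = a h) \/
  (exists j e, forall h x, P h x i = e (+) x j).
Hypothesis P_cross : forall x y, c [set P true x; P false y] = R.

Definition half_edge h v x := [set P h (line_point v x true); P h (line_point v x false)].

Lemma half_edgeE h v x z z' : z != z' ->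
  [set P h (line_point v x z); P h (line_point v x z')] = half_edge h v x.
Proof. by case: z z' => [] [] // _; rewrite setUC. Qed.

Definition mono_square := exists S : {set point bool m}, subcube 2 S /\
  exists col : 'I_2, forall e : {set point bool m},
    #|e| = 2 -> e \subset S -> c e = col.

(** The base points in the two halves may differ: off the support of [v] a coordinate then depends
    only on the half, which [bool_fun_sign] makes admissible. *)
Lemma mono_square_cross v (x : bool -> point bool d) :
  nonzero v -> (forall h, c (half_edge h v (x h)) = R) -> mono_square.
Proof.
move=> vn hv.
pose f (z : point bool 2) := P (z ord_max) (line_point v (x (z ord_max)) (z ord0)).
exists [set f z | z in [set: point bool 2]]; split.
  exists f; split=> //; apply: cube_param_map => [z w|i].
    by move/P_inj => [h1 /(line_point_inj vn) h0]; apply: point2P.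
  case: (P_coord i) => [[a Pa]|[j [e Pe]]].
    have [[b ab]|[e ae]] := bool_fun_sign a; [left; exists b | right; exists ord_max, e];
      by move=> z; rewrite /f Pa.
  case vj: (v j) => [e'|].
    right; exists ord0, (e (+) e') => z; rewrite /f Pe ffunE vj addbA //.
  have [[b ab]|[e' ae]] := bool_fun_sign (fun h => e (+) x h j);
    [left; exists b | right; exists ord_max, e'];
    by move=> z; rewrite /f Pe ffunE vj.
exists R => e /subset_image_pair he /he[z [w [zw ->]]].
have [E|] := eqVneq (z ord_max) (w ord_max).
  rewrite /f -E half_edgeE //; apply: contra zw => /eqP h0.
  by rewrite (point2P h0 E).
by rewrite /f; case: (z ord_max) (w ord_max) => [] [] // _; rewrite 1?setUC P_cross.
Qed.

Lemma mono_square_half h (a b : vec d) k :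
  disjoint_vec a b -> nonzero a -> nonzero b ->
  (forall v x, v \in [:: a; b; addv a b; subv a b] -> c (half_edge h v x) = k) ->
  mono_square.
Proof.
move=> dab an bn hk; pose f z := P h (plane_point a b z).
exists [set f z | z in [set: point bool 2]]; split.
  exists f; split=> //; apply: cube_param_map => [z w|i].
    move/P_inj => [_ /ffunP pzw]; apply: point2P.
      case: an => j; have := pzw j; rewrite !ffunE.
      by case: (a j) => // e; case: e (z _) (w _) => [] [] [].
    case: bn => j; have := pzw j; rewrite !ffunE.
    case: (dab j) => -> //; case: (b j) => // e.
    by case: e (z _) (w _) => [] [] [].
  case: (P_coord i) => [[q Pq]|[j [e Pe]]]; first by
    left; exists (q h) => z; rewrite /f Pq.
  case aj: (a j) => [e'|].
    by right; exists ord0, (e (+) e') => z; rewrite /f Pe ffunE aj addbA.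
  case bj: (b j) => [e'|].
    by right; exists ord_max, (e (+) e') => z; rewrite /f Pe ffunE aj bj addbA.
  by left; exists (e (+) true) => z; rewrite /f Pe ffunE aj bj.
exists k => e /subset_image_pair he /he[z [w [zw ->]]].
have [v [l [x [hv zl -> ->]]]] : exists v l x,
    [/\ v \in [:: a; b; addv a b; subv a b],
    z l != w l, f z = P h (line_point v x (z l)) & f w = P h (line_point v x (w l))].
  have [v [l [x [hv zl pz pw]]]] := plane_point_line dab zw.
  by exists v, l, x; rewrite /f pz pw.
by rewrite half_edgeE // hk.
Qed.

Lemma mono_square_exists r : 2 ^ 7 <= r -> ramsey_bound r 9 5 <= d -> mono_square.
Proof.
move=> hr hd.
pose chi h v := [exists x, c (half_edge h v x) == R].
case: (classic (exists v, [/\ nonzero v, chi true v & chi false v])).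
  move=> [v [vn /existsP[x /eqP cx] /existsP[y /eqP cy]]].
  by apply: (@mono_square_cross v (fun h => if h then x else y)) => // -[].
move=> nochi.
have [a [b [[dab an bn] [ca cs cd]]]] := same_color_directions (chi true) hr hd.
(* By [nochi], the half [~~ chi true b] has no edge of colour [R] in any of the four directions;
   [rev_ord R] is the other colour. *)
apply: (@mono_square_half (~~ chi true b) a b (rev_ord R)) => // v x hv.
have vn : nonzero v.
  have [j aj] := an.
  move: hv; rewrite !inE => /or4P[] /eqP -> //; exists j; rewrite ffunE;
    by case: (a j) aj.
have cv : chi true v = chi true b.
  by move: hv; rewrite !inE => /or4P[] /eqP ->.
have : c (half_edge (~~ chi true b) v x) != R.
  rewrite -cv; apply/negP => cR.
  have h : chi (~~ chi true v) v by apply/existsP; exists x.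
  case E: (chi true v) h => /= h; last by rewrite E in h.
  by apply: nochi; exists v.
move: (c _) R => [p hp] [q hq]; rewrite -val_eqE /= => pq; apply/val_inj => /=.
lia.
Qed.

End TwoHalves.

(** * From tic-tac-toe spaces to subcubes *)

(* The letter [a] of [[4]] encodes the pair of signs [(letter_half true a,
   letter_half false a)], in such a way that [flip 4] negates both. *)
Definition letter_half (h : bool) (a : 'I_4) : bool := if h then a < 2 else odd a.

Definition letter (x y : bool) : 'I_4 := inord (y + (~~ x).*2).

Lemma letterK h x y : letter_half h (letter x y) = if h then x else y.
Proof. by rewrite /letter_half /letter; case: h x y => [] [] []; rewrite /= inordK. Qed.

Lemma letter_half_group s : s \in ttt_group 4 ->
  exists e, forall h a, letter_half h (s a) = e (+) letter_half h a.
Proof.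
move/set2P => [] ->; first by exists false => h a; rewrite perm1.
exists true => h a; rewrite permE.
by case: h; case: a => [[|[|[|[|//]]]] ?].
Qed.

(* A word over [4] encodes an edge of the cube in the direction of the last
   coordinate, with end points [half true w] and [half false w]. *)
Definition half n (h : bool) (w : point 'I_4 n) : point bool n.+1 :=
  [ffun i => if unlift ord_max i is Some j then letter_half h (w j) else h].

Lemma ttt_gr_unavoidable r d n : 2 ^ 7 <= r -> ramsey_bound r 9 5 <= d ->
  ttt_unavoidable 4 2 d n -> gr_unavoidable 2 n.+1.
Proof.
move=> hr hd httt c.
have [_ [[g [[g_inj g_coord] ->]] [R hR]]] :=
  httt (fun w => c [set half true w; half false w]).
pose pairv (x y : point bool d) : point 'I_4 d := [ffun j => letter (x j) (y j)].
have half_lift h w j : half h w (lift ord_max j) = letter_half h (w j).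
  by rewrite ffunE liftK.
pose P h x := half h (g (pairv x x)).
(* Each half reads only its own component of [pairv x y], so every edge between the halves comes
   from a word of the monochromatic space. *)
have PE h x y : half h (g (pairv x y)) = P h (if h then x else y).
  apply/ffunP => i; case: (unliftP ord_max i) => [j ->|->]; last by
    rewrite !ffunE unlift_none.
  rewrite !half_lift; case: (g_coord j) => [[a ga]|[l [s [sG gs]]]]; first by rewrite !ga.
  have [e es] := letter_half_group sG.
  by rewrite !gs !es !ffunE !letterK; case: (h).
apply: (@mono_square_exists d _ c R P) hr hd.
- move=> h x h' y /ffunP Pxy.
  have hh : h = h' by have := Pxy ord_max; rewrite !ffunE unlift_none.
  split=> //; have : pairv x x = pairv y y; last first.
    move/ffunP=> xy; apply/ffunP => j.
    by have := congr1 (letter_half true) (xy j); rewrite !ffunE !letterK.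
  apply: g_inj; apply/ffunP => i.
  have := Pxy (lift ord_max i); rewrite -hh !half_lift.
  case: (g_coord i) => [[a ga]|[l [s [sG gs]]]]; first by rewrite !ga.
  have [e es] := letter_half_group sG.
  rewrite !gs !es !ffunE !letterK !if_same => /addbI ->; done.
- move=> i; case: (unliftP ord_max i) => [j ->|->]; last first.
    by left; exists id => h x; rewrite ffunE unlift_none.
  case: (g_coord j) => [[a ga]|[l [s [sG gs]]]].
    by left; exists (letter_half^~ a) => h x; rewrite half_lift ga.
  have [e es] := letter_half_group sG.
  right; exists l, e => h x; rewrite half_lift gs es ffunE letterK.
  by rewrite if_same.
- move=> x y; rewrite -(PE true x y) -(PE false x y).
  by apply: hR; apply/imsetP; exists (pairv x y).
Qed.

Lemma ttt_unavoidable_exists d : exists n, ttt_unavoidable 4 2 d n.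
Proof. exact: param_subset_ramsey ord0 d. Qed.

Lemma is_least_exists (Q : nat -> Prop) n : Q n -> exists m, is_least Q m.
Proof.
elim/ltn_ind: n => n IH Qn.
case: (classic (exists2 m, m < n & Q m)) => [[m mn Qm]|no].
  exact: IH Qm.
exists n; split=> // m Qm; rewrite leqNgt; apply/negP => mn.
by apply: no; exists m.
Qed.

Lemma gr_le_ttt r d : 2 ^ 7 <= r -> ramsey_bound r 9 5 <= d ->
  exists gr ttt : nat, [/\ is_Gr 2 gr, is_TTT 4 2 d ttt & gr <= ttt + 1].
Proof.
move=> hr hd.
have [n hn] := ttt_unavoidable_exists d.
have [ttt httt] := is_least_exists hn.
have hgr := ttt_gr_unavoidable hr hd httt.1.
have [gr gr_least] := is_least_exists hgr.
by exists gr, ttt; split=> //; rewrite addn1; apply: gr_least.2.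
Qed.

Theorem theorem1p4 :
  (exists d : nat, 0 < d /\
     exists gr ttt : nat,
       [/\ is_Gr 2 gr, is_TTT 4 2 d ttt & gr <= ttt + 1]) /\
  (0 < up_up 2 18 /\
     exists gr ttt : nat,
       [/\ is_Gr 2 gr, is_TTT 4 2 (up_up 2 18) ttt & gr <= ttt + 1]).
Proof.
have pos := up_up_gt0 18.
have main := gr_le_ttt (leqnn (2 ^ 7)) (leq_trans ramsey_bound_up_up (up_up_leqS 17)).
exact: (conj (ex_intro _ (up_up 2 18) (conj pos main)) (conj pos main)).
Qed.
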